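(* If $K\subset\mathbb{R}^{2n}$ is a toric convex domain, then the identity matrix $\mathbb{I}\in\mathrm{Sp}(2n)$ is a local minimum of the function $\mathrm{Sp}(2n)\to\mathbb{R}$ defined by $P\mapsto\mathrm{M}(PK)$. Moreover, if $K$ is a toric convex body which is strictly convex and has a $C^2$-smooth boundary, then $\mathbb{I}\in\mathrm{Sp}(2n)$ is an isolated local minimum of this function.
   Context: For a bounded subset $X\subset\mathbb{R}^{d}$, the support function is $h_X(u)=\sup_{k\in X}\langle k,u\rangle$ and the mean width is $\mathrm{M}(X)=\int_{S^{d-1}}(h_X(u)+h_X(-u))\,d\sigma$, where $\sigma$ is the rotationally invariant probability measure on the unit sphere $S^{d-1}\subset\mathbb{R}^d$. $\mathrm{Sp}(2n)$ is the group of real symplectic $2n\times 2n$ matrices, and $PK$ is the image of $K$ under $P$. Identify $\mathbb{R}^{2n}$ (coordinates $(x_1,\dots,x_n,y_1,\dots,y_n)$) with $\mathbb{C}^n$ via $z_j=x_j+iy_j$. A subset of $\mathbb{R}^{2n}=\mathbb{C}^n$ is toric if it is invariant under the standard action of the $n$-dimensional torus, $(\theta_1,\dots,\theta_n)\cdot(z_1,\dots,z_n)=(e^{i\theta_1}z_1,\dots,e^{i\theta_n}z_n)$. A toric convex domain (or toric convex body) is a convex body (compact convex set with nonempty interior) that is toric.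
   Formalization: The mean width is invariant under rotations, so it is constant on U(n) and the identity is never literally an isolated local minimum; ''isolated'' is read modulo U(n): every local minimum of P ↦ M(PK) on Sp(2n) near the identity lies in U(n). *)

(* Defs.v *)
From HB Require Import structures.
From mathcomp Require Import all_boot all_order all_algebra.
From mathcomp Require Import all_classical all_reals all_analysis.

Set Implicit Arguments.
Unset Strict Implicit.
Unset Printing Implicit Defensive.

Import Order.TTheory GRing.Theory Num.Theory.
Import numFieldNormedType.Exports.

Local Open Scope classical_set_scope.
Local Open Scope ring_scope.

Section MeanWidth.
Variables (R : realType) (d : nat).

Definition dotv (u v : 'cV[R]_d) : R := \sum_(i < d) u i 0 * v i 0.

(* The library norm on matrices is the sup norm, so the Euclidean sphere is
   defined from the inner product. *)
Definition unit_sphere : set 'cV[R]_d := [set u | dotv u u = 1].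

Definition orthogonal_group : set 'M[R]_d := [set O | O^T *m O = 1%:M].

Definition borel_cV := g_sigma_algebraType (@open 'cV[R]_d).

(* The rotationally invariant probability measure on the sphere, seen as a
   Borel probability measure on R^d carried by the sphere: the two conditions
   determine it uniquely for d >= 1. Invariance is required under all of O(d);
   for d >= 2 the resulting measure is the same as for SO(d). *)
Definition rotation_invariant_sphere_measure (sigma : probability borel_cV R) :=
  sigma unit_sphere = 1%E /\
  forall O, orthogonal_group O ->
    forall A : set borel_cV, measurable A -> sigma (mulmx O @^-1` A) = sigma A.

Definition support_fun (X : set 'cV[R]_d) (u : 'cV[R]_d) : R :=
  sup [set dotv k u | k in X].

Definition mean_width (sigma : probability borel_cV R) (X : set 'cV[R]_d) : R :=
  \int[sigma]_(u in unit_sphere) (support_fun X u + support_fun X (- u)).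

End MeanWidth.

Section ConvexBodies.
Variables (R : realType) (d : nat).
Implicit Type K : set 'cV[R]_d.

Definition convex_body K := [/\ compact K, convex_set K & K° !=set0].

Definition strictly_convex K :=
  forall (x y : 'cV[R]_d) (t : R), K x -> K y -> x != y -> 0 < t < 1 ->
    K° (t *: x + (1 - t) *: y).

Definition topological_boundary K := closure K `\` K°.

Definition C1_on (V : set 'cV[R]_d) (g : 'cV[R]_d -> R) :=
  forall x, V x -> forall v : 'cV[R]_d,
    derivable g x v /\ {for x, continuous ('D_v g)}.

Definition C2_on (V : set 'cV[R]_d) (g : 'cV[R]_d -> R) :=
  C1_on V g /\ forall v : 'cV[R]_d, C1_on V ('D_v g).

(* The boundary is a C^2 hypersurface: locally, it is the regular zero set of
   a C^2 function. *)
Definition C2_boundary K :=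
  forall p, topological_boundary K p ->
    exists (V : set 'cV[R]_d) (g : 'cV[R]_d -> R),
      [/\ open V, V p, C2_on V g,
          forall x, V x -> exists v : 'cV[R]_d, 'D_v g x != 0 &
          topological_boundary K `&` V = [set x | g x = 0] `&` V].

End ConvexBodies.

Section Symplectic.
Variables (R : realType) (n : nat).

(* Coordinates on R^(n+n) are (x_1, .., x_n, y_1, .., y_n). *)

(* z_j |-> e^(i theta_j) z_j in the real coordinates z_j = x_j + i y_j *)
Definition torus_act (theta : 'I_n -> R) (v : 'cV[R]_(n + n)) : 'cV[R]_(n + n) :=
  let x j := v (lshift n j) 0 in
  let y j := v (rshift n j) 0 in
  col_mx (\col_j (cos (theta j) * x j - sin (theta j) * y j))
         (\col_j (sin (theta j) * x j + cos (theta j) * y j)).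

Definition toric (X : set 'cV[R]_(n + n)) :=
  forall theta : 'I_n -> R, torus_act theta @` X = X.

Definition toric_convex_domain (K : set 'cV[R]_(n + n)) :=
  convex_body K /\ toric K.

Definition sympl_form : 'M[R]_(n + n) := block_mx 0 1%:M (- 1%:M) 0.

Definition Sp : set 'M[R]_(n + n) :=
  [set P | P^T *m sympl_form *m P = sympl_form].

(* U(n), as a subgroup of the real (n + n) x (n + n) matrices *)
Definition unitary_group : set 'M[R]_(n + n) :=
  Sp `&` @orthogonal_group R (n + n).

End Symplectic.

Arguments Sp : clear implicits.
Arguments unitary_group : clear implicits.

(* The function is only considered on A, with the subspace topology. *)
Definition local_min (R : realType) (T : topologicalType) (A : set T)
    (f : T -> R) (a : T) :=
  A a /\ \forall x \near within A (nbhs a), f a <= f x.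

(* Isolated local minimum modulo left multiplication by G: every local minimum
   of f on A that is close enough to P lies in the orbit G P. With G = {1} this
   is the usual notion. The quotient by G is needed for P |-> M(PK): it is
   constant on the orbits of G = U(n), because M is invariant under rotations,
   so that the local minimum at 1 is never isolated in Sp(2n) itself. *)
Definition isolated_local_min_mod (R : realType) (m : nat)
    (A G : set 'M[R]_m) (f : 'M[R]_m -> R) (P : 'M[R]_m) :=
  local_min A f P /\
  \forall Q \near within A (nbhs P),
    local_min A f Q -> exists2 U, G U & Q = U *m P.

(* In particular, such a local minimum is strict modulo G. *)
Lemma isolated_local_min_mod_strict (R : realType) (m : nat)
    (A G : set 'M[R]_m) (f : 'M[R]_m -> R) (P : 'M[R]_m) :
  isolated_local_min_mod A G f P ->
  \forall Q \near within A (nbhs P),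
    ~ (exists2 U, G U & Q = U *m P) -> f P < f Q.
Proof.
move=> [[_ minP] isoP].
have {}minP : \forall Q \near nbhs P, A Q -> f P <= f Q by exact: minP.
have {}isoP : \forall Q \near nbhs P, A Q ->
  local_min A f Q -> exists2 U, G U & Q = U *m P by exact: isoP.
have minP2 := near_join minP.
rewrite near_withinE; near=> Q => AQ notGQ; rewrite ltNge; apply/negP => fQP; apply: notGQ.
have isoQ : A Q -> local_min A f Q -> exists2 U, G U & Q = U *m P.
  by near: Q.
apply: isoQ => //; split=> //.
have minQ : \forall Q' \near nbhs Q, A Q' -> f P <= f Q'.
  by near: Q.
by apply: filterS minQ => Q' minQ' AQ'; exact: le_trans fQP (minQ' AQ').
Unshelve. all: by end_near. Qed.

(* Main.v *)
Require Import Defs.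
From HB Require Import structures.
From mathcomp Require Import all_boot all_order all_algebra.
From mathcomp Require Import all_classical all_reals all_analysis.
From mathcomp Require Import finmap measurable_realfun.
From mathcomp Require Import ring lra.

Import Order.TTheory GRing.Theory Num.Theory.
Import numFieldNormedType.Exports.

Local Open Scope classical_set_scope.
Local Open Scope ring_scope.

(** Write w u = h_K u + h_K (- u) for the width of K in the direction u. It is a
    norm, and M(PK) = N P, where N P is the average of w (P^T u) over the
    sphere. This N is a seminorm on matrices, it satisfies N (O P) = N P for O
    orthogonal because the measure is rotation invariant, and N (P J) = N P for
    the complex structure J because a toric body is invariant under
    multiplication by i. Everything follows from these facts.

    For P symplectic let P' = J^T P J. Then N P' = N P, and the symplectic
    condition reads P P'^T = 1. The complex linear part C = (P + P') / 2 and
    the antilinear part L = (P - P') / 2 satisfy C C^T = 1 + L L^T, so C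
    expands lengths.

    The basic inequality is that N ((1 - a v v^T) M) <= N M when
    0 <= a |v|^2 <= 2, since 1 - a v v^T is a convex combination of the identity
    and of the reflection along v ([rank1_contraction]). A matrix A with
    A A^T = 1 + L L^T is reduced to an orthogonal one by multiplying it
    by one such rank one contraction for each column of L, so N M <= N (A M)
    ([expansion_le]). With A = C this gives N 1 <= N C <= (N P + N P') / 2 = N P:
    the identity is even a global minimum ([Sp_seminorm_min]).

    For the isolation, it is shown that no P in Sp(2n) with P != P' is a local
    minimum; since P = P' means P in U(n), this is the claim. With Q = P P^T,
    the curve P_t = (1 + t Q)^-1 (P + t P') stays in Sp(2n) and tends to P as t
    tends to 0 ([sympl_flow_Sp], [sympl_flow_cvg]). With D = P - P', its first
    order part is the mean of (1 - 4t) P + 4t P', where N is at most N P, and of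
    (1 - 2t D D^T) P, where N is at most N P - 2 k t with k > 0
    ([contraction_first_order]). Hence N P_t < N P for small t > 0
    ([sympl_flow_decreases]). That k > 0 is the strict inequality
    N ((1 - v v^T / |v|^2) P) < N P ([spherical_average_strict]): w (P^T u) is a
    norm of u, so that convexity along the reflection of v is strict at u = v/|v|,
    and the measure charges every neighbourhood of every point of the sphere
    ([open_sphere_gt0]). *)

Set Implicit Arguments.
Unset Strict Implicit.
Unset Printing Implicit Defensive.

(** * The inner product *)

Section Dot.
Variables (R : realType) (d : nat).
Implicit Types (u v w : 'cV[R]_d) (A B : 'M[R]_d).

Lemma trmx_mul_dotv u v : u^T *m v = (dotv u v)%:M.
Proof.
apply/matrixP => i j; rewrite !ord1 !mxE eqxx mulr1n.
by apply: eq_bigr => k _; rewrite mxE.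
Qed.

Lemma dotvC u v : dotv u v = dotv v u.
Proof. by apply: eq_bigr => i _; rewrite mulrC. Qed.

Lemma dotvDl u v w : dotv (u + v) w = dotv u w + dotv v w.
Proof. by rewrite -big_split; apply: eq_bigr => i _; rewrite mxE mulrDl. Qed.

Lemma dotvDr u v w : dotv u (v + w) = dotv u v + dotv u w.
Proof. by rewrite dotvC dotvDl !(dotvC u). Qed.

Lemma dotvZl a u v : dotv (a *: u) v = a * dotv u v.
Proof. by rewrite mulr_sumr; apply: eq_bigr => i _; rewrite mxE mulrA. Qed.

Lemma dotvZr a u v : dotv u (a *: v) = a * dotv u v.
Proof. by rewrite dotvC dotvZl dotvC. Qed.

Lemma dotvNl u v : dotv (- u) v = - dotv u v.
Proof. by rewrite -scaleN1r dotvZl mulN1r. Qed.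

Lemma dotvNr u v : dotv u (- v) = - dotv u v.
Proof. by rewrite dotvC dotvNl dotvC. Qed.

Lemma dotv_mulmxl A u v : dotv (A *m u) v = dotv u (A^T *m v).
Proof.
have /matrixP/(_ 0 0) : (A *m u)^T *m v = u^T *m (A^T *m v).
  by rewrite trmx_mul mulmxA.
by rewrite !trmx_mul_dotv !mxE eqxx !mulr1n.
Qed.

Lemma dotv_ge0 u : 0 <= dotv u u.
Proof. by apply: sumr_ge0 => i _; exact: sqr_ge0. Qed.

Lemma dotv_eq0 u : (dotv u u == 0) = (u == 0).
Proof.
apply/eqP/eqP => [u0|->]; last by rewrite /dotv big1 // => i _; rewrite mxE mul0r.
apply/colP => i; rewrite mxE; apply/eqP; rewrite -sqrf_eq0 expr2.
by have /psumr_eq0P/(_ i isT)/eqP := u0; apply => k _; exact: sqr_ge0.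
Qed.

Lemma dotv_gt0 u : (0 < dotv u u) = (u != 0).
Proof. by rewrite lt_def dotv_ge0 andbT dotv_eq0. Qed.

Lemma mulmx_tr_cols m (L : 'M[R]_(d, m)) :
  L *m L^T = \sum_i col i L *m (col i L)^T.
Proof.
apply/matrixP => i j; rewrite summxE mxE; apply: eq_bigr => k _.
by rewrite !mxE big_ord1 !mxE.
Qed.

End Dot.

(** * Rank one contractions and left invariant seminorms *)

Section LeftInvariantSeminorms.
Variables (R : realType) (d : nat).
Implicit Types (u v : 'cV[R]_d) (A B M P : 'M[R]_d).

Record left_invariant_seminorm (N : 'M[R]_d -> R) : Prop := {
  seminormD : forall A B, N (A + B) <= N A + N B;
  seminormZ : forall a A, N (a *: A) = `|a| * N A;
  seminormO : forall O A, orthogonal_group O -> N (O *m A) = N A }.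

Definition householder v : 'M[R]_d := 1%:M - (2 / dotv v v) *: (v *m v^T).

Lemma rank1_square (a b : R) v :
  (a *: (v *m v^T)) *m (b *: (v *m v^T)) = (a * b * dotv v v) *: (v *m v^T).
Proof.
rewrite -scalemxAl -scalemxAr -mulmxA (mulmxA v^T) trmx_mul_dotv mul_scalar_mx.
by rewrite -scalemxAr !scalerA mulrA.
Qed.

Lemma tr_rank1 v : (v *m v^T)^T = v *m v^T.
Proof. by rewrite trmx_mul trmxK. Qed.

Lemma tr_householder v : (householder v)^T = householder v.
Proof. by rewrite linearB /= trmx1 linearZ /= tr_rank1. Qed.

Lemma householder_orthogonal v : orthogonal_group (householder v).
Proof.
rewrite /orthogonal_group /= tr_householder /householder.
rewrite mulmxBl mul1mx mulmxBr mulmx1 rank1_square.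
have [->|v0] := eqVneq v 0; first by rewrite mul0mx !scaler0 !subr0.
have -> : 2 / dotv v v * (2 / dotv v v) * dotv v v = 2 * (2 / dotv v v).
  by field; rewrite gt_eqF// dotv_gt0.
move: (v *m v^T) (2 / dotv v v) => Q c.
by apply/matrixP => i j; rewrite !mxE; ring.
Qed.

Variables (N : 'M[R]_d -> R) (Ninv : left_invariant_seminorm N).

Let ND := seminormD Ninv.
Let NZ := seminormZ Ninv.
Let NO := seminormO Ninv.

Lemma seminorm_sum I (r : seq I) (F : I -> 'M[R]_d) :
  N (\sum_(i <- r) F i) <= \sum_(i <- r) N (F i).
Proof.
elim: r => [|i r IH]; last by rewrite !big_cons (le_trans (ND _ _))// lerD2l.
by rewrite !big_nil -(scale0r (0 : 'M[R]_d)) NZ normr0 mul0r.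
Qed.

Lemma seminormN A : N (- A) = N A.
Proof. by rewrite -scaleN1r NZ normrN1 mul1r. Qed.

Lemma seminorm_conv (p : R) A B : 0 <= p <= 1 ->
  N ((1 - p) *: A + p *: B) <= (1 - p) * N A + p * N B.
Proof.
move=> /andP[p0 p1]; rewrite (le_trans (ND _ _))// !NZ.
by rewrite !ger0_norm // subr_ge0.
Qed.

(** With p = a |v|^2 / 2 in [0, 1], the matrix 1 - a v v^T is the convex
    combination of the identity and of the reflection along v with weights
    1 - p and p. *)
Lemma rank1_contraction a v M : 0 <= a -> a * dotv v v <= 2 ->
  N ((1%:M - a *: (v *m v^T)) *m M) <= N M.
Proof.
move=> a0 av.
have [v0|v0] := eqVneq v 0; first by rewrite v0 mul0mx scaler0 subr0 mul1mx.
have vv : 0 < dotv v v by rewrite dotv_gt0.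
pose p := a * dotv v v / 2.
have -> : (1%:M - a *: (v *m v^T)) *m M
    = (1 - p) *: M + p *: (householder v *m M).
  rewrite !mulmxBl !mul1mx -!scalemxAl scalerBr scalerA.
  have -> : p * (2 / dotv v v) = a by rewrite /p; field; rewrite gt_eqF.
  by rewrite scalerBl scale1r addrA subrK.
have pI : 0 <= p <= 1.
  by rewrite /p divr_ge0 ?mulr_ge0 ?(ltW vv)//= ler_pdivrMr// mul1r.
rewrite (le_trans (seminorm_conv _ _ pI)) // NO; last exact: householder_orthogonal.
by rewrite -mulrDl subrK mul1r.
Qed.

(** Convexity on the segment from M to its projection (1 - v v^T / |v|^2) M
    makes the decrease at least linear in a. *)
Lemma rank1_contraction_gap a v M : 0 <= a -> a * dotv v v <= 1 ->
  N ((1%:M - a *: (v *m v^T)) *m M) <=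
  N M - a * dotv v v *
    (N M - N ((1%:M - (dotv v v)^-1 *: (v *m v^T)) *m M)).
Proof.
move=> a0 av.
have [v0|v0] := eqVneq v 0.
  by rewrite v0 mul0mx !scaler0 subr0 mul1mx subrr mulr0 subr0.
have vv : 0 < dotv v v by rewrite dotv_gt0.
set p := a * dotv v v in av *.
rewrite {1}(_ : (1%:M - a *: (v *m v^T)) *m M = (1 - p) *: M +
    p *: ((1%:M - (dotv v v)^-1 *: (v *m v^T)) *m M)); last first.
  rewrite !mulmxBl !mul1mx -!scalemxAl scalerBr scalerA.
  have -> : p * (dotv v v)^-1 = a by rewrite /p mulfK ?gt_eqF.
  by rewrite scalerBl scale1r addrA subrK.
rewrite (le_trans (seminorm_conv _ _ _)) ?av ?andbT ?mulr_ge0 ?(ltW vv)//.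
by rewrite le_eqVlt; apply/orP; left; apply/eqP; ring.
Qed.

(** If |v|^2 = s, these conditions on b say that 1 - b v v^T is a rank one
    contraction whose square is the inverse of 1 + v v^T. *)
Lemma rank1_inverse_root (s : R) : 0 <= s ->
  exists b, [/\ 0 <= b, b * s <= 2 & b * b * s + (1 - b * s) ^+ 2 = 2 * b].
Proof.
move=> s0; pose r := Num.sqrt (1 + s).
have sE : s = r ^+ 2 - 1 by rewrite sqr_sqrtr ?addr_ge0// addrC addKr.
have r1 : 1 <= r by rewrite -[leLHS]sqrtr1 ler_wsqrtr// lerDl.
have r0 : r != 0 by rewrite gt_eqF//; lra.
have r10 : r + 1 != 0 by rewrite gt_eqF//; lra.
(* On v the contraction 1 - b v v^T acts as 1 - b s = 1 / r; the solution
   b = (r - 1) / (r s) is written so as to make sense for s = 0. *)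
exists (r * (r + 1))^-1; split.
- by rewrite invr_ge0; apply: mulr_ge0; lra.
- rewrite mulrC ler_pdivrMr; last by apply: mulr_gt0; lra.
  by rewrite sE; nra.
- by rewrite sE; field; rewrite r0 r10.
Qed.

(** Left multiplication by an expanding matrix does not decrease N. If l is the first
    column of L and Z = 1 - b l l^T satisfies Z (1 + l l^T) Z = 1, then Z A
    satisfies the hypothesis with one column less, and N (Z A M) <= N (A M);
    when no column is left, A is orthogonal. *)
Lemma expansion_le k (L : 'M[R]_(d, k)) A M :
  A *m A^T = 1%:M + L *m L^T -> N M <= N (A *m M).
Proof.
elim: k L A => [|k IH] L A AL.
  rewrite NO // /orthogonal_group /=; apply: mulmx1C.
  by rewrite AL thinmx0 mul0mx addr0.
pose l : 'cV[R]_d := @lsubmx R d 1 k L.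
pose L' : 'M[R]_(d, k) := @rsubmx R d 1 k L.
have LE : L *m L^T = l *m l^T + L' *m L'^T.
  have := mul_row_col l L' l^T L'^T.
  by rewrite -tr_row_mx (@hsubmxK _ d 1 k L).
pose s := dotv l l.
have [b [b0 bs bE]] := rank1_inverse_root (dotv_ge0 l).
pose Z : 'M[R]_d := 1%:M - b *: (l *m l^T).
have ZT : Z^T = Z by rewrite linearB /= trmx1 linearZ /= tr_rank1.
have ZZ : Z *m (1%:M + l *m l^T) *m Z = 1%:M.
  have QQ : (l *m l^T) *m (l *m l^T) = s *: (l *m l^T).
    by have := rank1_square 1 1 l; rewrite !scale1r !mul1r.
  rewrite /Z; move: (l *m l^T) QQ => Q QQ.
  rewrite !(mulmxDl, mulmxDr, mulmxN, mulNmx, mul1mx, mulmx1).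
  rewrite -!(scalemxAl, scalemxAr) !(mulmxDl, mulmxDr, mulmxN, mulNmx, mul1mx, mulmx1, QQ).
  rewrite -!(scalemxAl, scalemxAr) QQ.
  apply/matrixP => i j; rewrite !mxE; set e := (_ *+ _).
  transitivity (e + Q i j * (b * b * s + (1 - b * s) ^+ 2 - 2 * b)); last first.
    by rewrite bE subrr mulr0 addr0.
  by ring.
apply: (@le_trans _ _ (N (Z *m (A *m M)))); last exact: rank1_contraction.
rewrite mulmxA; apply: (IH (Z *m L')).
rewrite !trmx_mul ZT mulmxA -(mulmxA Z A) AL LE addrA (mulmxDr Z) (mulmxDl _ _ Z) ZZ.
by rewrite !mulmxA.
Qed.

(** As D D^T is the sum of c c^T over the d columns c of D, the matrix
    1 - t D D^T is the mean of the rank one contractions 1 - t d c c^T. None of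
    them increases N, and the one of index i lowers it at a rate linear in t. *)
Lemma contraction_first_order t P (D : 'M[R]_d) i :
  0 <= t -> (forall j, t * d%:R * dotv (col j D) (col j D) <= 1) ->
  N ((1%:M - t *: (D *m D^T)) *m P) <=
  N P - t * dotv (col i D) (col i D) *
   (N P - N ((1%:M - (dotv (col i D) (col i D))^-1 *:
      (col i D *m (col i D)^T)) *m P)).
Proof.
move=> t0 tD; set gap := _ * _.
have d0 : (0 : R) < d%:R by rewrite ltr0n (leq_trans _ (ltn_ord i)).
pose F j := d%:R^-1 *: ((1%:M - (t * d%:R) *: (col j D *m (col j D)^T)) *m P).
have -> : (1%:M - t *: (D *m D^T)) *m P = \sum_j F j.
  rewrite -scaler_sumr -mulmx_suml sumrB sumr_const card_ord -scaler_sumr.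
  rewrite -mulmx_tr_cols scalemxAl; congr (_ *m _).
  rewrite -[1%:M *+ d]scaler_nat; move: (D *m D^T) 1%:M => Q E.
  by apply/matrixP => j k; rewrite !mxE; field; rewrite gt_eqF.
apply: (le_trans (seminorm_sum _ _)).
have dV : 0 <= (d%:R : R)^-1 by rewrite invr_ge0 ltW.
have td0 : 0 <= t * d%:R by rewrite mulr_ge0// ltW.
apply: (@le_trans _ _ (\sum_j d%:R^-1 * (N P - (if j == i then d%:R * gap else 0)))).
  apply: ler_sum => j _; rewrite /F NZ ger0_norm// ler_wpM2l//.
  case: eqP => [->|_].
    have -> : d%:R * gap = t * d%:R * dotv (col i D) (col i D) *
      (N P - N ((1%:M - (dotv (col i D) (col i D))^-1 *:
      (col i D *m (col i D)^T)) *m P)) by rewrite /gap; ring.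
    exact: rank1_contraction_gap.
  by rewrite subr0; apply: rank1_contraction => //; rewrite (le_trans (tD j))//; lra.
rewrite -mulr_sumr sumrB sumr_const card_ord -big_mkcond big_pred1_eq /=.
rewrite -[N P *+ d]mulr_natl -mulrBr mulrA mulVf ?mul1r// gt_eqF//.
Qed.

End LeftInvariantSeminorms.

(** * Symplectic matrices *)

Section SymplecticDescent.
Variables (R : realType) (n : nat).
Let d := (n + n)%N.
Let J : 'M[R]_d := sympl_form R n.
Implicit Types (P M A : 'M[R]_(n + n)).

Lemma sympl_form_tr : J^T = - J.
Proof.
rewrite /J /sympl_form tr_block_mx !trmx0 linearN /= !trmx1.
by rewrite opp_block_mx !oppr0 opprK.
Qed.

Lemma sympl_form_trM : J^T *m J = 1%:M.
Proof.
rewrite sympl_form_tr /J /sympl_form opp_block_mx mulmx_block.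
by rewrite !(oppr0, mulNmx, mulmxN, opprK, mul0mx, mulmx0, mulmx1, addr0, add0r) scalar_mx_block.
Qed.

Lemma sympl_form_Mtr : J *m J^T = 1%:M.
Proof. exact: mulmx1C sympl_form_trM. Qed.

(** Conjugation by J, that is by multiplication by i: it fixes complex linear
    maps and changes the sign of antilinear ones. For symplectic P it is the
    inverse of P^T. *)
Definition sympl_dual P : 'M[R]_(n + n) := J^T *m P *m J.

Lemma sympl_dualM A B : sympl_dual (A *m B) = sympl_dual A *m sympl_dual B.
Proof.
rewrite /sympl_dual !mulmxA -(mulmxA _ J J^T) sympl_form_Mtr mulmx1.
by rewrite -!mulmxA.
Qed.

Lemma sympl_dual_tr A : sympl_dual A^T = (sympl_dual A)^T.
Proof. by rewrite /sympl_dual !trmx_mul trmxK mulmxA. Qed.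

Lemma sympl_dual1 : sympl_dual 1%:M = 1%:M.
Proof. by rewrite /sympl_dual mulmx1 sympl_form_trM. Qed.

Lemma sympl_dualK : involutive sympl_dual.
Proof.
have JJ : J *m J = - 1%:M.
  by apply: oppr_inj; rewrite opprK -mulNmx -sympl_form_tr sympl_form_trM.
move=> A; rewrite /sympl_dual !mulmxA -(mulmxA _ J J) JJ.
by rewrite sympl_form_tr !(mulNmx, mulmxN, opprK, mulmx1) JJ mulNmx mul1mx opprK.
Qed.

Lemma sympl_dualD A B : sympl_dual (A + B) = sympl_dual A + sympl_dual B.
Proof. by rewrite /sympl_dual mulmxDr mulmxDl. Qed.

Lemma sympl_dualZ a A : sympl_dual (a *: A) = a *: sympl_dual A.
Proof. by rewrite /sympl_dual -scalemxAr -scalemxAl. Qed.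

Lemma Sp_dualP P : Sp R n P <-> (sympl_dual P)^T *m P = 1%:M.
Proof.
rewrite /Sp /= -/J /sympl_dual !trmx_mul trmxK; split=> [PJ|PJ].
  by rewrite -mulmxA PJ sympl_form_trM.
have := congr1 (mulmx J) PJ.
by rewrite !mulmxA sympl_form_Mtr mul1mx mulmx1.
Qed.


Lemma Sp_dual_relations P : Sp R n P ->
  [/\ (sympl_dual P)^T *m P = 1%:M, P *m (sympl_dual P)^T = 1%:M,
      P^T *m sympl_dual P = 1%:M & sympl_dual P *m P^T = 1%:M].
Proof.
move=> /Sp_dualP PP; have PP' := mulmx1C PP; split=> //.
  by apply: trmx_inj; rewrite trmx_mul trmxK trmx1.
by apply: trmx_inj; rewrite trmx_mul trmxK trmx1.
Qed.

Lemma gram_unit m (P : 'M[R]_m) t : 0 <= t -> 1%:M + t *: (P *m P^T) \in unitmx.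
Proof.
move=> t0; rewrite -row_free_unit; apply: inj_row_free => x xA.
have : dotv x^T x^T + t * dotv (x *m P)^T (x *m P)^T = 0.
  have /matrixP/(_ 0 0) := congr1 (mulmx^~ x^T) xA.
  rewrite mul0mx mulmxDr mulmx1 -scalemxAr mulmxDl -scalemxAl.
  have -> : x *m (P *m P^T) *m x^T = (x *m P)^T^T *m (x *m P)^T.
    by rewrite trmxK trmx_mul !mulmxA.
  by rewrite -{1}[x]trmxK !trmx_mul_dotv !mxE eqxx !mulr1n.
move/eqP; rewrite paddr_eq0 ?dotv_ge0 ?mulr_ge0 ?dotv_ge0// => /andP[].
by rewrite dotv_eq0 => /eqP x0 _; apply: trmx_inj; rewrite x0 trmx0.
Qed.

(** For P symplectic and Q = P P^T this is f(Q) P with f(q) = (1 + t / q) / (1 + t q).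
    Since J^T Q J = Q^-1 and f(q) f(1/q) = 1, the matrix f(Q) is symplectic. At
    t = 0 its derivative is J^T P J - Q P. *)
Definition sympl_flow P t : 'M[R]_(n + n) :=
  invmx (1%:M + t *: (P *m P^T)) *m (P + t *: sympl_dual P).

Lemma sympl_flowE P t : 0 <= t ->
  (1%:M + t *: (P *m P^T)) *m sympl_flow P t = P + t *: sympl_dual P.
Proof. by move=> t0; rewrite mulmxA mulmxV ?mul1mx// gram_unit. Qed.

Lemma sympl_flow_Sp P t : Sp R n P -> 0 <= t -> Sp R n (sympl_flow P t).
Proof.
move=> PSp t0; apply/Sp_dualP; apply: mulmx1C.
have [r1 r2 r3 r4] := Sp_dual_relations PSp.
have AE := sympl_flowE P t0.
have A'E := congr1 sympl_dual AE.
move: (gram_unit P t0) (gram_unit (sympl_dual P) t0).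
rewrite sympl_dualM !sympl_dualD sympl_dual1 !sympl_dualZ sympl_dualM in A'E.
rewrite sympl_dual_tr sympl_dualK in A'E.
move: (sympl_flow P t) (sympl_dual P) => F P' in r1 r2 r3 r4 AE A'E *.
set A := 1%:M + _ in AE *; set A' := 1%:M + _ in A'E * => uA uA'.
have symA' : A'^T = A'.
  by rewrite /A' linearD /= trmx1 linearZ /= trmx_mul trmxK.
have AA' : (P + t *: P') *m (P' + t *: P)^T = A *m A'.
  rewrite /A /A' linearD /= linearZ /=.
  rewrite !(mulmxDl, mulmxDr, mul1mx, mulmx1) -?(scalemxAl, scalemxAr).
  rewrite -(mulmxA P P^T) (mulmxA P^T P') r3 mul1mx r2 r4.
  by move: 1%:M (P *m P^T) (P' *m P'^T) => X Y Z; apply/matrixP => i j; rewrite !mxE; ring.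
apply: (can_inj (mulKmx uA)); apply: (can_inj (mulmxK uA')).
rewrite mulmx1 -AA' -AE -A'E.
by rewrite (trmx_mul A') symA' !mulmxA.
Qed.

Lemma sympl_flow_fixpoint P t : 0 <= t ->
  sympl_flow P t = P + t *: (sympl_dual P - P *m P^T *m sympl_flow P t).
Proof.
move=> /(sympl_flowE P); rewrite mulmxDl mul1mx -scalemxAl => /(canRL (addrK _)) E.
by rewrite [LHS]E scalerBr addrA.
Qed.

(** The first order part P + t (P' - Q P), where P' = J^T P J, is split into the
    mean of a point of the segment from P to P' and of a contraction of P. This
    uses D D^T P = Q P + P' - 2 P, a consequence of P P'^T = 1. *)
Lemma sympl_flow_expansion P t : Sp R n P -> 0 <= t ->
  let Q := P *m P^T in let D := P - sympl_dual P in
  sympl_flow P t = 2^-1 *: ((1 - 4 * t) *: P + (4 * t) *: sympl_dual P)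
    + 2^-1 *: ((1%:M - (2 * t) *: (D *m D^T)) *m P)
    + t ^+ 2 *: (Q *m Q *m sympl_flow P t - P).
Proof.
move=> PSp t0 Q D; have [r1 r2 r3 r4] := Sp_dual_relations PSp.
have := sympl_flow_fixpoint P t0; rewrite {}/D -/Q.
move: (sympl_flow P t) (sympl_dual P) r1 r2 r3 r4 => F P' r1 r2 r3 r4 FE.
have DP : (P - P') *m (P - P')^T *m P = Q *m P + P' - 2 *: P.
  rewrite linearB /= !(mulmxBl, mulmxBr) r2 r4 !mul1mx -(mulmxA P') r1 mulmx1.
  by move: (Q *m P) => X; apply/matrixP => i j; rewrite !mxE; ring.
have QF : Q *m F = Q *m P + t *: (P - Q *m Q *m F).
  rewrite [in LHS]FE mulmxDr -scalemxAr mulmxBr (mulmxA Q Q).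
  by rewrite -(mulmxA P _ P') r3 mulmx1.
rewrite [LHS]FE QF mulmxBl mul1mx -scalemxAl DP.
move: (Q *m Q *m _) (Q *m P) => X Y.
by apply/matrixP => i j; rewrite !mxE; field.
Qed.

Variable N : 'M[R]_(n + n) -> R.
Hypotheses (Ninv : left_invariant_seminorm N) (NJ : forall A, N (A *m J) = N A).

Let ND := seminormD Ninv.
Let NZ := seminormZ Ninv.
Let NO := seminormO Ninv.

Lemma seminorm_sympl_dual A : N (sympl_dual A) = N A.
Proof.
rewrite NJ NO // /orthogonal_group /= trmxK; exact: sympl_form_Mtr.
Qed.

(** The complex linear part C of P is the midpoint of P and J^T P J, at which N
    takes the same value, and C C^T = 1 + L L^T where L is the antilinear part. *)
Lemma Sp_seminorm_min P : Sp R n P -> N 1%:M <= N P.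
Proof.
move=> PSp; have [r1 r2 r3 r4] := Sp_dual_relations PSp.
pose C := (1 - 2^-1) *: P + 2^-1 *: sympl_dual P.
pose L := 2^-1 *: (P - sympl_dual P).
apply: (@le_trans _ _ (N (C *m 1%:M))).
  apply: (expansion_le Ninv (L := L)).
  rewrite /C /L !(linearD, linearZ, linearN) /=.
  rewrite !(mulmxDl, mulmxDr, mulmxN, mulNmx) -?(scalemxAl, scalemxAr) !(mulmxDl, mulmxDr, mulmxN, mulNmx) -?(scalemxAl, scalemxAr) r2 r4.
  by move: 1%:M (P *m _) (sympl_dual P *m _) => X Y Z; apply/matrixP => i j; rewrite !mxE; field.
rewrite mulmx1 (le_trans (seminorm_conv Ninv _ _ _))//; first by lra.
by rewrite seminorm_sympl_dual -mulrDl subrK mul1r.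
Qed.

(** By [sympl_flow_expansion], N decreases along the flow at first order in t,
    at a rate which is positive because D has a nonzero column; the remainder is
    at most B t^2. *)
Lemma sympl_flow_decreases P : Sp R n P -> P != sympl_dual P ->
  (forall v, v != 0 -> N ((1%:M - (dotv v v)^-1 *: (v *m v^T)) *m P) < N P) ->
  exists2 t1, 0 < t1 & forall t, 0 < t <= t1 -> N (sympl_flow P t) < N P.
Proof.
move=> PSp PP' strictP.
pose D := P - sympl_dual P; pose Q := P *m P^T.
have [i Di] : exists i, col i D != 0.
  apply/existsP; apply: contraR PP'; rewrite negb_exists => /forallP D0.
  rewrite -subr_eq0; apply/eqP/matrixP => k i; rewrite mxE.
  by have /negPn/eqP/colP/(_ k) := D0 i; rewrite !mxE.
pose s j := dotv (col j D) (col j D).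
pose gap := s i * (N P - N ((1%:M - (s i)^-1 *: (col i D *m (col i D)^T)) *m P)).
have gap0 : 0 < gap by rewrite mulr_gt0 ?dotv_gt0// subr_gt0 strictP.
have N0 A : 0 <= N A.
  have := ND A (- A); rewrite (seminormN Ninv) subrr -(scale0r A) NZ normr0 mul0r.
  by lra.
pose B := N (Q *m Q *m P) + N (Q *m Q *m sympl_dual P) + N P.
have B0 : 0 <= B by rewrite !addr_ge0.
pose S := 2 * d%:R * \sum_j s j.
have S0 : 0 <= S.
  by rewrite mulr_ge0 ?mulr_ge0 ?sumr_ge0// => j _; exact: dotv_ge0.
have B1 : 0 < (B + 1) / gap by rewrite divr_gt0//; lra.
(* Each summand gives one of the bounds needed on t: that (1 - 4t) P + 4t P' is
   a convex combination, that the rank one contractions stay in the range of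
   contraction_first_order, and that B t^2 < t gap. *)
exists (4 + S + (B + 1) / gap)^-1; first by rewrite invr_gt0; lra.
move=> t /andP[t0 tle].
have {}tle : t * (4 + S + (B + 1) / gap) <= 1.
  by rewrite -ler_pdivlMr ?div1r//; lra.
have tB : t * (B + 1) <= gap.
  rewrite -[leRHS]mul1r -ler_pdivrMr// -mulrA.
  have tS4 : 0 <= t * (4 + S) by apply: mulr_ge0; lra.
  by move: tle; rewrite mulrDr; lra.
have tS0 : 0 <= t * S by apply: mulr_ge0; lra.
have tB0 : 0 <= t * ((B + 1) / gap) by apply: mulr_ge0; lra.
move: tle; rewrite !mulrDr => tle.
have tS : t * S <= 1 by lra.
have t4 : 4 * t <= 1 by lra.
have t0' := ltW t0.
rewrite (sympl_flow_expansion PSp t0') -/D -/Q.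
have h1 : N (2^-1 *: ((1 - 4 * t) *: P + (4 * t) *: sympl_dual P)) <= 2^-1 * N P.
  rewrite NZ ger0_norm ?ler_wpM2l ?invr_ge0//.
  rewrite (le_trans (seminorm_conv Ninv _ _ _))//; first by lra.
  by rewrite seminorm_sympl_dual -mulrDl subrK mul1r.
have h2 : N (2^-1 *: ((1%:M - (2 * t) *: (D *m D^T)) *m P)) <= 2^-1 * (N P - 2 * t * gap).
  rewrite NZ ger0_norm ?ler_wpM2l ?invr_ge0//.
  have -> : 2 * t * gap = 2 * t * s i * (N P - N ((1%:M - (s i)^-1 *: (col i D *m (col i D)^T)) *m P)).
    by rewrite /gap; ring.
  apply: (contraction_first_order Ninv); first by lra.
  move=> j; rewrite (le_trans _ tS)//.
  have -> : t * S = 2 * t * d%:R * \sum_j s j by rewrite /S; ring.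
  rewrite ler_wpM2l ?mulr_ge0// (bigD1 j)//= lerDl sumr_ge0// => k _.
  exact: dotv_ge0.
have h3 : N (t ^+ 2 *: (Q *m Q *m sympl_flow P t - P)) <= t ^+ 2 * B.
  rewrite NZ ger0_norm ?sqr_ge0// ler_wpM2l ?sqr_ge0//.
  rewrite (le_trans (ND _ _))// (seminormN Ninv) lerD2r.
  (* (1 + t Q)^2 = 1 + 2t P P^T + (t Q)^2, so 1 + t Q is expanding and N does
     not increase under its inverse. *)
  pose L := row_mx (Num.sqrt (2 * t) *: P) (t *: Q).
  apply: (@le_trans _ _ (N ((1%:M + t *: Q) *m (Q *m Q *m sympl_flow P t)))).
    apply: (expansion_le Ninv (L := L)).
    rewrite /L tr_row_mx mul_row_col !linearD /= !linearZ /= trmx1.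
    have -> : Q^T = Q by rewrite /Q trmx_mul trmxK.
    rewrite -?(scalemxAl, scalemxAr) scalerA -expr2 sqr_sqrtr; last by lra.
    rewrite !(mulmxDl, mulmxDr, mul1mx, mulmx1) -?(scalemxAl, scalemxAr) -/Q.
    by clearbody Q; move: 1%:M (Q *m Q) => X Y; apply/matrixP => k j; rewrite !mxE; ring.
  have -> : (1%:M + t *: Q) *m (Q *m Q *m sympl_flow P t)
    = Q *m Q *m ((1%:M + t *: Q) *m sympl_flow P t).
    by rewrite !(mulmxDl, mulmxDr, mul1mx) -?(scalemxAl, scalemxAr) !mulmxA.
  rewrite sympl_flowE// mulmxDr (le_trans (ND _ _))// lerD2l -scalemxAr NZ.
  by rewrite ger0_norm// ler_piMl//; lra.
rewrite (le_lt_trans (ND _ _))// (le_lt_trans (lerD (ND _ _) (lexx _)))//.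
by nra.
Qed.

End SymplecticDescent.

(** * Topology of matrices and of the sphere *)

Section MatrixNorm.
Variable R : realType.

Lemma mx_norm_entry m n (A : 'M[R]_(m, n)) i j : `|A i j| <= `|A|.
Proof.
rewrite [leRHS]/Num.norm /= mx_normrE; apply/bigmax_geP; right => /=.
by exists (i, j).
Qed.

Lemma mx_norm_le m n (A : 'M[R]_(m, n)) c :
  0 <= c -> (forall i j, `|A i j| <= c) -> `|A| <= c.
Proof.
move=> c0 Ac; rewrite [leLHS]/Num.norm /= mx_normrE.
by apply/bigmax_leP; split=> // -[i j] _; exact: Ac.
Qed.

Lemma mx_norm_mul m n p (A : 'M[R]_(m, n)) (B : 'M[R]_(n, p)) :
  `|A *m B| <= n%:R * `|A| * `|B|.
Proof.
apply: mx_norm_le => [|i j]; first by rewrite !mulr_ge0.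
rewrite mxE (le_trans (ler_norm_sum _ _ _))//.
rewrite -mulrA mulr_natl -[X in _ *+ X]card_ord -sumr_const ler_sum// => k _.
by rewrite normrM ler_pM// mx_norm_entry.
Qed.

End MatrixNorm.

(** In [sympl_flow_fixpoint] the unknown occurs with a factor t, so for small t
    the flow stays bounded, and then its distance to P is of order t. *)
Lemma sympl_flow_cvg (R : realType) n (P : 'M[R]_(n + n)) e : 0 < e ->
  exists2 t1, 0 < t1 & forall t, 0 < t <= t1 -> `|P - sympl_flow P t| < e.
Proof.
move=> e0; pose Q := P *m P^T; pose P' := sympl_dual P.
pose c := (n + n)%:R * `|Q|; pose b := 2 * (`|P| + `|P'|).
have c0 : 0 <= c by rewrite mulr_ge0.
have b0 : 0 <= b by rewrite mulr_ge0 ?addr_ge0.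
have P'0 : 0 <= `|P'| by [].
have P0 : 0 <= `|P| by [].
have X0 : 0 <= (`|P'| + c * b + 1) / e.
  by rewrite divr_ge0// ?addr_ge0 ?mulr_ge0// ltW.
exists (1 + 2 * c + (`|P'| + c * b + 1) / e)^-1; first by rewrite invr_gt0; lra.
move=> t /andP[t0]; rewrite -[leRHS]mul1r ler_pdivlMr; last by lra.
rewrite !mulrDr mulr1 mulrCA => tle.
have tc0 : 0 <= t * c by rewrite mulr_ge0// ltW.
have tX0 : 0 <= t * ((`|P'| + c * b + 1) / e) by rewrite mulr_ge0// ltW.
have FE := sympl_flow_fixpoint P (ltW t0).
set F := sympl_flow P t in FE *.
have QF : `|Q *m F| <= c * `|F| by exact: mx_norm_mul.
have FPn : `|P - F| <= t * (`|P'| + c * `|F|).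
  rewrite distrC {1}FE addrC addKr mx_normZ gtr0_norm// ler_wpM2l ?(ltW t0)//.
  by rewrite (le_trans (ler_normB _ _))// lerD2l.
have Fb : `|F| <= b.
  have : `|F| <= `|P| + `|P - F| by rewrite -lerBlDl distrC lerB_dist.
  have F0 : 0 <= `|F| by [].
  have : t * c * `|F| <= 2^-1 * `|F| by rewrite ler_wpM2r//; lra.
  have : t * `|P'| <= `|P'| by rewrite ler_piMl//; lra.
  rewrite /b; move: FPn; rewrite mulrDr mulrA; lra.
rewrite (le_lt_trans FPn)//.
have : t * (`|P'| + c * `|F|) <= t * (`|P'| + c * b).
  by rewrite ler_wpM2l ?(ltW t0)// lerD2l ler_wpM2l.
have : t * (`|P'| + c * b + 1) <= e.
  by rewrite -[leRHS]mul1r -ler_pdivrMr// -mulrA; lra.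
rewrite mulrDr mulr1; lra.
Qed.

Lemma lipschitz_continuous (R : realType) (V W : normedModType R) (f : V -> W) c :
  (forall u v, `|f u - f v| <= c * `|u - v|) -> continuous f.
Proof.
move=> fc u; apply/cvgrPdist_lt => e e0; near=> v.
rewrite (le_lt_trans (fc _ _))// (@le_lt_trans _ _ ((`|c| + 1) * `|u - v|))//.
  by rewrite ler_wpM2r// ler_wpDr// ler_norm.
rewrite mulrC -ltr_pdivlMr; last by rewrite ltr_wpDl.
near: v; apply: cvgr_dist_lt => //.
by rewrite divr_gt0// ltr_wpDl.
Unshelve. all: by end_near. Qed.

Section VectorSeminorms.
Variables (R : realType) (d : nat).

Record vector_seminorm (q : 'cV[R]_d -> R) : Prop := {
  vseminormD : forall u v, q (u + v) <= q u + q v;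
  vseminormZ : forall a u, q (a *: u) = `|a| * q u }.

Variables (q : 'cV[R]_d -> R) (qS : vector_seminorm q).

Lemma vseminorm0 : q 0 = 0.
Proof. by rewrite -(scale0r 0) (vseminormZ qS) normr0 mul0r. Qed.

Lemma vseminormN u : q (- u) = q u.
Proof. by rewrite -scaleN1r (vseminormZ qS) normrN1 mul1r. Qed.

Lemma vseminorm_ge0 u : 0 <= q u.
Proof.
have := vseminormD qS u (- u); rewrite subrr vseminorm0 vseminormN.
by lra.
Qed.

Lemma vseminorm_bounded : exists2 c, 0 <= c & forall u, q u <= c * `|u|.
Proof.
exists (\sum_(i < d) q (delta_mx i 0)).
  by apply: sumr_ge0 => i _; exact: vseminorm_ge0.
move=> u; rewrite [u in q u]matrix_sum_delta.
rewrite (eq_bigr (fun i => u i 0 *: delta_mx i 0)); last by move=> i _; rewrite big_ord1.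
apply: (@le_trans _ _ (\sum_(i < d) q (u i 0 *: delta_mx i 0))).
  elim/big_rec2: _ => [|i a b _ ab]; first by rewrite vseminorm0.
  by rewrite (le_trans (vseminormD qS _ _))// lerD2l.
rewrite mulr_suml ler_sum// => i _.
by rewrite (vseminormZ qS) mulrC ler_wpM2l ?vseminorm_ge0 ?mx_norm_entry.
Qed.

Lemma vseminorm_dist u v : `|q u - q v| <= q (u - v).
Proof.
have h x y : q x - q y <= q (x - y).
  by rewrite lerBlDr (le_trans _ (vseminormD qS _ _))// subrK.
by rewrite ler_norml h andbT lerNl opprB (le_trans (h _ _))// -vseminormN opprB.
Qed.

Lemma vseminorm_continuous : continuous q.
Proof.
have [c c0 qc] := vseminorm_bounded; apply: (@lipschitz_continuous _ _ _ _ c) => u v.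
exact: le_trans (vseminorm_dist _ _) (qc _).
Qed.

Lemma vseminorm_mulmx (A : 'M[R]_d) : vector_seminorm (fun u => q (A *m u)).
Proof.
split=> [u v|a u]; first by rewrite mulmxDr (vseminormD qS).
by rewrite -scalemxAr (vseminormZ qS).
Qed.

End VectorSeminorms.

Section BorelSphere.
Variables (R : realType) (d : nat).
Local Notation S := (@unit_sphere R d).

Lemma open_borel (U : set 'cV[R]_d) : open U -> measurable (U : set (borel_cV R d)).
Proof. by move=> oU; exact: sub_sigma_algebra. Qed.

Lemma continuous_borel (f : 'cV[R]_d -> R) : continuous f ->
  measurable_fun [set: borel_cV R d] (f : borel_cV R d -> R).
Proof.
move=> /continuousP cf; apply: (measurability _ (RGenOpens.measurableE R)).
move=> _ [_ [a [b ->] <-]]; rewrite setTI; apply: open_borel.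
exact/cf/interval_open.
Qed.

Lemma mulmx_continuous (A : 'M[R]_d) : continuous (fun u : 'cV[R]_d => A *m u).
Proof.
apply: (@lipschitz_continuous _ _ _ _ (d%:R * `|A|)) => u v.
by rewrite -mulmxBr mx_norm_mul.
Qed.

Lemma mulmx_borel (A : 'M[R]_d) :
  measurable_fun [set: borel_cV R d] (mulmx A : borel_cV R d -> borel_cV R d).
Proof.
have /continuousP cA := @mulmx_continuous A.
apply: (measurability _ (erefl (@open 'cV[R]_d).-sigma.-measurable)).
move=> _ [U oU <-]; rewrite setTI; apply: open_borel.
exact: cA.
Qed.

Lemma dotv_continuous : continuous (fun u : 'cV[R]_d => dotv u u).
Proof.
apply: continuous_big => [|i _ u]; first exact: add_continuous.
have cu : {for u, continuous (fun v : 'cV[R]_d => v i 0)}.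
  exact: (@coord_continuous R d 1 i 0).
exact: continuousM.
Qed.

Lemma unit_sphere_closed : closed S.
Proof.
have -> : S = (fun u => dotv u u) @^-1` [set 1] by [].
apply: preimage_closed; last exact: closed_eq.
by move=> u _; exact: dotv_continuous.
Qed.

Lemma unit_sphere_borel : measurable (S : set (borel_cV R d)).
Proof.
rewrite -[S]setCK; apply: measurableC; apply: open_borel.
exact/closed_openC/unit_sphere_closed.
Qed.

Lemma unit_sphere_norm (u : 'cV[R]_d) : S u -> `|u| <= 1.
Proof.
move=> Su; apply: mx_norm_le => // i j; rewrite ord1.
rewrite -(@expr_le1 _ 2)// -normrX ger0_norm ?sqr_ge0// -[leRHS]Su /dotv (bigD1 i)//= expr2 lerDl.
by apply: sumr_ge0 => k _; exact: sqr_ge0.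
Qed.

(** Needed to transport compactness of closed bounded sets from row vectors to
    column vectors. *)
Lemma trmx_continuous m n : continuous (@trmx R m n).
Proof.
apply: (@lipschitz_continuous _ _ _ _ 1) => u v; rewrite mul1r -linearB /=.
by apply: mx_norm_le => // i j; rewrite mxE mx_norm_entry.
Qed.

Lemma unit_sphere_compact : compact S.
Proof.
have -> : S = trmx @` ((fun u : 'rV[R]_d => u^T) @^-1` S).
  rewrite eqEsubset; split=> [u Su|_ [u Su <-]//].
  by exists u^T; rewrite /= ?trmxK.
apply: continuous_compact; first by apply: continuous_subspaceT; exact: trmx_continuous.
apply: bounded_closed_compact.
  exists 1; split=> // M M1 u Su /=.
  rewrite (le_trans _ (ltW M1))// -[u]trmxK (le_trans _ (unit_sphere_norm Su))//.
  by apply: mx_norm_le => // i j; rewrite mxE mx_norm_entry.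
apply: preimage_closed; last exact: unit_sphere_closed.
by move=> u _; exact: trmx_continuous.
Qed.

End BorelSphere.

(** * Averages of norms over the sphere *)

Section SphericalAverage.
Variables (R : realType) (d : nat).
Variables (sigma : probability (borel_cV R d) R).
Hypothesis sigma_inv : rotation_invariant_sphere_measure sigma.
Local Notation S := (@unit_sphere R d).

Lemma vseminorm_integrable q : vector_seminorm q ->
  sigma.-integrable (S : set (borel_cV R d)) (EFin \o q).
Proof.
move=> qS; apply: measurable_bounded_integrable.
- exact: unit_sphere_borel.
- by rewrite (le_lt_trans (probability_le1 _ _)) ?ltry//; exact: unit_sphere_borel.
- apply: measurable_funTS; apply: continuous_borel; exact: vseminorm_continuous.
- have [c c0 qc] := vseminorm_bounded qS.
  exists c; split=> [|M cM u Su /=]; first exact: num_real.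
  rewrite ger0_norm ?(vseminorm_ge0 qS)// (le_trans (qc _))// (le_trans _ (ltW cM))//.
  by rewrite ler_piMr// unit_sphere_norm.
Qed.

Lemma rotation_unit_sphere (O : 'M[R]_d) : orthogonal_group O ->
  mulmx O @^-1` S = S.
Proof.
move=> OO; rewrite eqEsubset; split=> u;
  by rewrite /unit_sphere /= dotv_mulmxl mulmxA OO mul1mx.
Qed.

Lemma integral_rotation (O : 'M[R]_d) q : orthogonal_group O -> vector_seminorm q ->
  \int[sigma]_(u in S) q (O *m u) = \int[sigma]_(u in S) q u.
Proof.
move=> OO qS; rewrite /Rintegral; congr fine.
have mO := mulmx_borel O.
have mS : measurable (S : set (borel_cV R d)) by exact: unit_sphere_borel.
transitivity (\int[pushforward sigma (mulmx O : borel_cV R d -> borel_cV R d)]_(u in S) (q u)%:E)%E.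
  rewrite (ge0_integral_pushforward mO)//.
  - by rewrite rotation_unit_sphere.
  - apply/measurable_EFinP; apply: measurable_funTS; apply: continuous_borel.
    exact: vseminorm_continuous.
  - by move=> u _; rewrite lee_fin vseminorm_ge0.
apply: eq_measure_integral => A mA _; exact: sigma_inv.2.
Qed.

(** The reflection along u - e exchanges the unit vectors u and e, so the
    orthogonal group is transitive on the sphere. *)
Lemma rotation_to (u e : 'cV[R]_d) : S u -> S e ->
  householder (u - e) *m u = e.
Proof.
rewrite /unit_sphere /= => uu ee; rewrite /householder mulmxBl mul1mx -scalemxAl.
rewrite -mulmxA trmx_mul_dotv mul_mx_scalar scalerA.
have [->|ue] := eqVneq u e; first by rewrite subrr scaler0 subr0.
have : 2 / dotv (u - e) (u - e) * dotv (u - e) u = 1.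
  have ue0 : dotv (u - e) (u - e) != 0 by rewrite dotv_eq0 subr_eq0.
  apply: (mulIf ue0); rewrite mul1r mulrAC divfK//.
  rewrite !(dotvDl, dotvDr, dotvNl, dotvNr) uu ee (dotvC u e); ring.
by move=> ->; rewrite scale1r opprB addrC subrK.
Qed.

(** By transitivity the rotated copies of S `&` U cover the sphere; they have the
    same measure, and by compactness finitely many of them suffice. *)
Lemma open_sphere_gt0 (U : set 'cV[R]_d) e : open U -> U e -> S e ->
  (0 < sigma (S `&` U : set (borel_cV R d)))%E.
Proof.
move=> oU Ue Se; have mS : measurable (S : set (borel_cV R d)) by exact: unit_sphere_borel.
rewrite lt0e measure_ge0 andbT; apply/eqP => SU0.
pose f (u : 'cV[R]_d) := mulmx (householder (u - e)) @^-1` U.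
have := @unit_sphere_compact R d; rewrite compact_cover => /(_ _ S f).
case=> [u Su|u Su|D' _ SD'].
- by move/continuousP : (@mulmx_continuous R d (householder (u - e))); exact.
- by exists u => //; rewrite /f /= rotation_to.
pose g u := mulmx (householder (u - e)) @^-1` (S `&` U).
have mg u : measurable (g u : set (borel_cV R d)).
  rewrite -[g u]setTI; apply: mulmx_borel => //.
  by apply: measurableI => //; exact: open_borel.
have g0 u : sigma (g u) = 0%E.
  rewrite -SU0; apply: sigma_inv.2; first exact: householder_orthogonal.
  by apply: measurableI => //; exact: open_borel.
have : (sigma S <= \sum_(u \in [set` D']) sigma (g u))%E.
  apply: content_sub_fsum => // u Su; have [v Dv fv] := SD' _ Su.
  exists v => //; split=> //.
  by rewrite -[X in X _](rotation_unit_sphere (householder_orthogonal (v - e))) in Su.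
rewrite sigma_inv.1 fsbig1 => [|u _]; last exact: g0.
by rewrite lee_fin ler10.
Qed.

Variables (w : 'cV[R]_d -> R) (wS : vector_seminorm w).

(** The transpose turns images of the body under A into precomposition, and
    makes rotation invariance act on the left of A. *)
Definition spherical_average (A : 'M[R]_d) : R :=
  \int[sigma]_(u in S) w (A^T *m u).

Let integrable_w (A : 'M[R]_d) :
  sigma.-integrable (S : set (borel_cV R d)) (EFin \o (fun u => w (A *m u))).
Proof. by apply: vseminorm_integrable; exact: vseminorm_mulmx. Qed.

Lemma spherical_average_seminorm : left_invariant_seminorm spherical_average.
Proof.
have mS := @unit_sphere_borel R d.
split=> [A B|a A|O A OO].
- rewrite /spherical_average -RintegralD//; try exact: integrable_w.
  apply: le_Rintegral => //.
  + exact: (integrableD mS (integrable_w A^T) (integrable_w B^T)).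
  + by move=> u _; rewrite linearD /= mulmxDl (vseminormD wS).
- rewrite /spherical_average -RintegralZl//.
  apply: eq_Rintegral => u _.
  by rewrite linearZ /= -scalemxAl (vseminormZ wS).
- rewrite /spherical_average.
  rewrite -(integral_rotation (O := O^T) _ (vseminorm_mulmx wS A^T)).
    by apply: eq_Rintegral => u _; rewrite trmx_mul mulmxA.
  by rewrite /orthogonal_group /= trmxK; exact: mulmx1C.
Qed.

Hypothesis w_gt0 : forall u, u != 0 -> 0 < w u.

(** Let q u = w (P^T u) and let H be the reflection along v. By invariance under
    H, twice the difference of the two sides is the average of
    psi u = q u + q (H u) - q (u + H u), which is nonnegative and continuous,
    and equals 2 q e > 0 at e = v / |v| because H e = - e. *)
Lemma spherical_average_strict P v : P \in unitmx -> v != 0 ->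
  spherical_average ((1%:M - (dotv v v)^-1 *: (v *m v^T)) *m P)
    < spherical_average P.
Proof.
move=> uP v0; have mS := @unit_sphere_borel R d.
pose H := householder v.
pose q u := w (P^T *m u).
have qS : vector_seminorm q by exact: vseminorm_mulmx.
pose q2 u := q (u + H *m u).
have vv : 0 < dotv v v by rewrite dotv_gt0.
have q2S : vector_seminorm q2.
  have := vseminorm_mulmx qS (1%:M + H).
  by under eq_fun do rewrite mulmxDl mul1mx.
have qHS : vector_seminorm (fun u => q (H *m u)) by exact: vseminorm_mulmx.
pose psi u := q u + q (H *m u) - q2 u.
have psi_ge0 u : 0 <= psi u by rewrite subr_ge0 (vseminormD qS).
have iq := vseminorm_integrable qS; have iq2 := vseminorm_integrable q2S.
have iqH := vseminorm_integrable qHS.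
have iqqH : sigma.-integrable (S : set (borel_cV R d)) (EFin \o (fun u => q u + q (H *m u))).
  exact: (integrableD mS iq iqH).
have ipsi : sigma.-integrable (S : set (borel_cV R d)) (EFin \o psi).
  exact: (integrableB mS iqqH iq2).
have E : \int[sigma]_(u in S) psi u = 2 * (spherical_average P -
   spherical_average ((1%:M - (dotv v v)^-1 *: (v *m v^T)) *m P)).
  rewrite RintegralB// RintegralD// integral_rotation//; last exact: householder_orthogonal.
  rewrite mulrBr; congr (_ - _).
    by rewrite /spherical_average; ring.
  rewrite /spherical_average -RintegralZl//.
  apply: eq_Rintegral => u _.
  have -> : 2 = `|2 : R| by rewrite ger0_norm.
  rewrite -(vseminormZ wS) /q2 /q; congr w.
  rewrite trmx_mul -mulmxA scalemxAr; congr (_ *m _).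
  rewrite linearB /= trmx1 linearZ /= tr_rank1 /H /householder.
  rewrite !mulmxBl !mul1mx -!scalemxAl.
  move: (v *m v^T *m u) => x; apply/matrixP => i j; rewrite !mxE; ring.
rewrite -subr_gt0 -(pmulr_rgt0 _ (ltr0n R 2)) -E.
pose e := (Num.sqrt (dotv v v))^-1 *: v.
have sv : Num.sqrt (dotv v v) != 0 by rewrite gt_eqF// sqrtr_gt0.
have Se : S e.
  rewrite /unit_sphere /= dotvZl dotvZr mulrA -expr2 exprVn sqr_sqrtr ?(ltW vv)//.
  by rewrite mulVf// gt_eqF.
have e0 : e != 0 by rewrite scaler_eq0 negb_or invr_eq0 sv.
have He : H *m e = - e.
  rewrite /H /householder /e -scalemxAr mulmxBl mul1mx -scalemxAl -mulmxA.
  rewrite trmx_mul_dotv mul_mx_scalar scalerA divfK ?gt_eqF//.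
  by rewrite -[RHS]scalerN; congr (_ *: _); apply/matrixP => i j; rewrite !mxE; ring.
have qe : 0 < q e.
  apply: w_gt0; apply: contra e0 => /eqP Pe.
  have uPT : P^T \in unitmx by rewrite unitmx_tr.
  by rewrite -(mulKmx uPT e) Pe mulmx0.
have psie : psi e = 2 * q e.
  rewrite /psi /q2 He subrr (vseminormN qS) (vseminorm0 qS); ring.
have cpsi : continuous psi.
  move=> u; have [cq cqH cq2] : [/\ {for u, continuous q}, {for u, continuous (fun x => q (H *m x))} & {for u, continuous q2}].
    by split; exact: vseminorm_continuous.
  exact: cvgB (cvgD cq cqH) cq2.
pose U := psi @^-1` `]q e, +oo[.
have oU : open U by move/continuousP : cpsi; apply; exact: interval_open.
have Ue : U e by rewrite /U /= in_itv /= andbT psie; lra.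
have := open_sphere_gt0 oU Ue Se; set s := sigma _ => s0.
have mSU : measurable (S `&` U : set (borel_cV R d)).
  by apply: measurableI => //; exact: open_borel.
apply: (@lt_le_trans _ _ (q e * fine s)).
  rewrite mulr_gt0// fine_gt0// s0/= (le_lt_trans (probability_le1 _ _)) ?ltry//.
rewrite -Rintegral_cst//.
rewrite setIC Rintegral_mkcondl.
apply: le_Rintegral => //; last first.
  move=> u _; rewrite patchE; case: ifPn => // /set_mem.
  by rewrite /U /= in_itv /= andbT => /ltW.
apply: measurable_bounded_integrable => //.
- by rewrite (le_lt_trans (probability_le1 _ _)) ?ltry.
- by apply/measurable_restrict => //; exact: open_borel.
- exists (q e); split=> [|M qM u _ /=]; first exact: num_real.
  by rewrite patchE; case: ifPn => _; rewrite ?normr0 ?gtr0_norm//; lra.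
Qed.

End SphericalAverage.

(** * The width of a convex body *)

Section WidthFunction.
Variables (R : realType) (d : nat) (K : set 'cV[R]_d).
Hypothesis K_body : convex_body K.

Definition width (u : 'cV[R]_d) : R := support_fun K u + support_fun K (- u).

Lemma dotv_bounded : exists2 M, 0 <= M &
  forall k u, K k -> dotv k u <= M * `|u|.
Proof.
have [/compact_bounded[M [_ KM]] _ _] := K_body.
have M1 : M < `|M| + 1 by rewrite (le_lt_trans (ler_norm M))// ltrDl.
exists (d%:R * (`|M| + 1)) => [|k u Kk]; first by rewrite mulr_ge0// addr_ge0.
have kM : `|k| <= `|M| + 1 by exact: (KM _ M1 _ Kk).
have -> : dotv k u = (k^T *m u) 0 0 by rewrite trmx_mul_dotv mxE eqxx mulr1n.
rewrite (le_trans (ler_norm _))// (le_trans (mx_norm_entry _ _ _))//.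
rewrite (le_trans (mx_norm_mul _ _))// ler_wpM2r// ler_wpM2l//.
apply: le_trans kM; apply: mx_norm_le => // i j.
by rewrite mxE mx_norm_entry.
Qed.

Lemma support_set u : has_sup [set dotv k u | k in K].
Proof.
have [_ _ [k /interior_subset Kk]] := K_body; split; first by exists (dotv k u), k.
have [M _ KM] := dotv_bounded.
by exists (M * `|u|) => _ [l Kl <-]; exact: KM.
Qed.

Lemma support_ge k u : K k -> dotv k u <= support_fun K u.
Proof. by move=> Kk; apply: (sup_upper_bound (support_set u)); exists k. Qed.

Lemma support_le u c : (forall k, K k -> dotv k u <= c) -> support_fun K u <= c.
Proof.
move=> Kc; apply: ge_sup; first by have [] := support_set u.
by move=> _ [k Kk <-]; exact: Kc.
Qed.

Lemma support_sub u v : support_fun K (u + v) <= support_fun K u + support_fun K v.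
Proof. by apply: support_le => k Kk; rewrite dotvDr lerD// support_ge. Qed.

Lemma support_pos a u : 0 <= a -> support_fun K (a *: u) = a * support_fun K u.
Proof.
rewrite le_eqVlt => /predU1P[<-|a0].
  rewrite scale0r mul0r; apply/eqP; rewrite eq_le.
  have [_ _ [k /interior_subset Kk]] := K_body.
  have d0 (l : 'cV[R]_d) : dotv l 0 = 0 by rewrite -(scale0r 0) dotvZr mul0r.
  by rewrite support_le => [|l _]; rewrite ?d0// -(d0 k) support_ge.
apply/eqP; rewrite eq_le; apply/andP; split.
  by apply: support_le => k Kk; rewrite dotvZr ler_wpM2l ?(ltW a0)// support_ge.
rewrite mulrC -ler_pdivlMr//; apply: support_le => k Kk.
by rewrite ler_pdivlMr// mulrC -dotvZr support_ge.
Qed.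

Lemma width_seminorm : vector_seminorm width.
Proof.
split=> [u v|a u]; rewrite /width.
  by rewrite opprD addrACA lerD// support_sub.
have [a0|/ltW a0] := leP 0 a; first by rewrite -scalerN !support_pos// mulrDr ger0_norm.
have a0' : 0 <= - a by rewrite oppr_ge0.
have -> : a *: u = (- a) *: (- u) by rewrite scaleNr scalerN opprK.
by rewrite -scalerN opprK !support_pos// -mulrDr addrC ler0_norm.
Qed.

(** A ball contained in K has positive width in every direction. *)
Lemma width_gt0 u : u != 0 -> 0 < width u.
Proof.
move=> u0; have [_ _ [k /nbhs_ballP[e /= e0 Ke]]] := K_body.
have Kk : K k by apply: Ke; exact: ballxx.
have un : 0 < `|u| by rewrite normr_gt0.
pose a := e / 2 / `|u|.
have a0 : 0 < a by rewrite !divr_gt0.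
have Ka : K (k + a *: u).
  apply: Ke; rewrite -ball_normE /ball_ /= opprD addNKr normrN mx_normZ gtr0_norm//.
  by rewrite /a divfK ?gt_eqF//; lra.
have h1 := support_ge u Ka; have h2 := support_ge (- u) Kk.
move: h1 h2; rewrite dotvDl dotvNr dotvZl /width => h1 h2.
have : 0 < a * dotv u u by rewrite mulr_gt0// dotv_gt0.
by move: h1 h2; lra.
Qed.

Lemma support_fun_image (A : 'M[R]_d) u :
  support_fun (mulmx A @` K) u = support_fun K (A^T *m u).
Proof.
rewrite /support_fun; congr sup; rewrite eqEsubset; split.
  by move=> _ [_ [k Kk <-] <-]; exists k; rewrite // dotv_mulmxl.
by move=> _ [k Kk <-]; exists (A *m k); [exists k|rewrite dotv_mulmxl].
Qed.

Lemma mean_width_image (sigma : probability (borel_cV R d) R) (A : 'M[R]_d) :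
  mean_width sigma (mulmx A @` K) = spherical_average sigma width A.
Proof.
by apply: eq_Rintegral => u _; rewrite !support_fun_image /width mulmxN.
Qed.

End WidthFunction.

(** The form J acts as multiplication by - i, which is the element of the torus
    whose angles are all equal to - pi / 2. *)
Lemma toric_sympl_invariant (R : realType) n (K : set 'cV[R]_(n + n)) :
  toric K -> mulmx (sympl_form R n) @` K = K.
Proof.
move=> /(_ (fun=> - (pi / 2))) KT; rewrite -[RHS]KT; apply: eq_imagel => v _.
rewrite /torus_act cosN sinN cos_pihalf sin_pihalf.
rewrite -[v in LHS]vsubmxK /sympl_form mul_block_col !mul0mx mul1mx add0r addr0 mulNmx mul1mx.
by congr col_mx; apply/colP => j; rewrite !mxE ?mul0r ?mulN1r ?opprK ?mul1r ?add0r ?addr0.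
Qed.

(** * The minimum of the mean width *)

Theorem theorem1p4 (R : realType) (n : nat)
    (sigma : probability (borel_cV R (n + n)) R)
    (sigma_inv : rotation_invariant_sphere_measure sigma)
    (K : set 'cV[R]_(n + n)) (K_toric : toric_convex_domain K) :
  local_min (Sp R n)
    (fun P : 'M[R]_(n + n) => mean_width sigma (mulmx P @` K)) 1%:M
  /\
  (strictly_convex K -> C2_boundary K ->
   isolated_local_min_mod (Sp R n) (unitary_group R n)
     (fun P : 'M[R]_(n + n) => mean_width sigma (mulmx P @` K)) 1%:M).
Proof.
have [K_body KT] := K_toric.
have wS := width_seminorm K_body.
pose N := spherical_average sigma (width K).
have NE P : mean_width sigma (mulmx P @` K) = N P by exact: mean_width_image.
have Ninv : left_invariant_seminorm N by exact: spherical_average_seminorm.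
have NJ A : N (A *m sympl_form R n) = N A.
  rewrite -!NE -[in RHS](toric_sympl_invariant KT) image_comp.
  by congr (mean_width _ (_ @` _)); apply/funext => v; rewrite /= mulmxA.
have Sp1 : Sp R n 1%:M by rewrite /Sp /= trmx1 mul1mx mulmx1.
have min1 : local_min (Sp R n)
    (fun P : 'M[R]_(n + n) => mean_width sigma (mulmx P @` K)) 1%:M.
  split=> //; near=> P; rewrite !NE; apply: (Sp_seminorm_min Ninv NJ).
  by near: P; exact: withinT.
split=> // _ _; split=> //.
have main P : Sp R n P -> local_min (Sp R n)
    (fun P : 'M[R]_(n + n) => mean_width sigma (mulmx P @` K)) P ->
    unitary_group R n P.
  move=> PSp [_ minP]; split=> //.
  have [r1 r2 _ _] := Sp_dual_relations PSp.
  have [PP'|PP'] := eqVneq P (sympl_dual P).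
    by rewrite /orthogonal_group /= {1}PP' r1.
  have uP : P \in unitmx by have [] := mulmx1_unit r2.
  have [t1 t10 dec] := sympl_flow_decreases Ninv NJ PSp PP'
     (fun v => spherical_average_strict sigma_inv wS (width_gt0 K_body) uP).
  have /nbhs_ballP[e /= e0 Pe] : \forall Q \near nbhs P, Sp R n Q ->
    mean_width sigma (mulmx P @` K) <= mean_width sigma (mulmx Q @` K) by exact: minP.
  have [t2 t20 near2] := sympl_flow_cvg P e0.
  pose t := Num.min t1 t2.
  have t0 : 0 < t by rewrite lt_min t10.
  have := Pe (sympl_flow P t); rewrite -ball_normE /ball_ /= near2 ?t0 ?ge_min ?lexx ?orbT//.
  move=> /(_ isT (sympl_flow_Sp PSp (ltW t0))); rewrite !NE leNgt.
  by rewrite dec// t0 ge_min lexx.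
rewrite near_withinE; near=> P => PSp Pmin.
by exists P; [exact: main|rewrite mulmx1].
Unshelve. all: by end_near. Qed.
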